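(* Let $A\in\mathbb{C}^{n\times n}$ be involutory. Assume that $A$ has $\nu$ singular values $\sigma_1\ge\cdots\ge\sigma_\nu>1$. These singular values appear in pairs $(\sigma_j,\frac{1}{\sigma_j})$ associated with the singular triplets $(u_j,v_j,\sigma_j)$ and $(v_j,u_j,\frac{1}{\sigma_j})$, $j=1,\dots,\nu$. Assume further that $A$ has $\mu$ singular values $1$ which appear in pairs $(1,1)$ associated with the singular triplets $(\tilde u_j,\tilde v_j,1)$ and $(\tilde v_j,\tilde u_j,1)$, $j=1,\dots,\mu$. Finally, assume that $A$ has $k=n-2\nu-2\mu$ single singular values $1$ associated with the singular triplets $(\hat u_j,\pm\hat u_j,1)$, $j=1,\dots,k$. Thus the SVD $A=U\Sigma V^H$ of $A$ is given by $$\Sigma=\operatorname{diag}(S,\ I_\mu,\ I_\delta,\ S^{-1},\ I_\mu,\ I_\eta)$$ with $S=\operatorname{diag}(\sigma_1,\dots,\sigma_\nu)$ and $$U=[u_1,\dots,u_\nu,\ \tilde u_1,\dots,\tilde u_\mu,\ \hat u_1,\dots,\hat u_\delta,\ v_1,\dots,v_\nu,\ \tilde v_1,\dots,\tilde v_\mu,\ \hat u_{\delta+1},\dots,\hat u_{\eta+\delta}],$$ $$V=[v_1,\dots,v_\nu,\ \tilde v_1,\dots,\tilde v_\mu,\ \pm\hat u_1,\dots,\pm\hat u_\delta,\ u_1,\dots,u_\nu,\ \tilde u_1,\dots,\tilde u_\mu,\ \pm\hat u_{\delta+1},\dots,\pm\hat u_{\eta+\delta}],$$ where $\nu+\mu+\eta=m$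 and $\delta=\eta$ if $n=2m$, $\delta=\eta+1$ if $n=2m+1$. In particular, the signs do not need to be equal for all $\hat u_j$, $j=1,\dots,\delta+\eta$.
   Context: A matrix $A\in\mathbb{C}^{n\times n}$ is involutory if $A^2=I_n$, equivalently $A=A^{-1}$. $I_j$ is the $j\times j$ identity matrix and $X^H$ is the conjugate transpose of $X$. A singular value decomposition (SVD) of $A$ is a decomposition $A=U\Sigma V^H$ with $U,V\in\mathbb{C}^{n\times n}$ unitary and $\Sigma\in\mathbb{R}^{n\times n}$ diagonal with nonnegative diagonal entries, the singular values of $A$; in the SVD of the claim the diagonal of $\Sigma$ is arranged as displayed rather than sorted by magnitude. The columns of $U$ and of $V$ are the left and right singular vectors of $A$, respectively. Any triplet $(u,v,\sigma)$ with $Av=\sigma u$ is called a singular triplet of $A$. For involutory $A$, a singular triplet $(u,v,\sigma)$ is always accompanied by the singular triplet $(v,u,\frac{1}{\sigma})$. For $\sigma=1$: if $u\neq\pm v$, one speaks of a pair $(1,1)$ of singular values associated with the two triplets $(u,v,1)$ and $(v,u,1)$ (the number $\mu$ counts such pairs); if $v=u$ or $v=-u$, one speaks of a single singular value $1$ with the triplet $(u,u,1)$ or $(u,-u,1)$. The sign of $\pm\hat u_j$ in $V$ is the sign in the triplet $(\hat u_j,\pm\hat u_j,1)$. *)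

(* Defs.v *)
From mathcomp Require Import all_boot all_order all_algebra.
From mathcomp Require Import reals complex.

Set Implicit Arguments.
Unset Strict Implicit.
Unset Printing Implicit Defensive.

Import GRing.Theory Num.Theory.
Local Open Scope ring_scope.
Local Open Scope sesquilinear_scope.
Local Open Scope complex_scope.

Definition involutory (R : realType) (n : nat) (A : 'M[R[i]]_n) : Prop :=
  A *m A = 1%:M.

Definition is_svd (R : realType) (n : nat) (A U : 'M[R[i]]_n) (S : 'M[R]_n)
    (V : 'M[R[i]]_n) : Prop :=
  [/\ U \is unitarymx, V \is unitarymx, is_diag_mx S,
      forall i, 0 <= S i i
    & A = U *m map_mx (real_complex R) S *m V ^t*].

(* Only A v = s u is required; no normalization, no condition on A^H u. *)
Definition singular_triplet (R : realType) (n : nat) (A : 'M[R[i]]_n)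
    (u v : 'cV[R[i]]_n) (s : R) : Prop :=
  A *m v = s%:C *: u.

Definition triplet_at (R : realType) (n : nat) (U : 'M[R[i]]_n) (S : 'M[R]_n)
    (V : 'M[R[i]]_n) (x : 'I_n) (u v : 'cV[R[i]]_n) (s : R) : Prop :=
  [/\ col x U = u, col x V = v & S x x = s].

(* Column j of sd_U, sd_V (resp. sd_Ut, sd_Vt; sd_Uh) is u_j, v_j (resp.
   u~_j, v~_j; u^_j); the j-th sign is (-1) ^+ sd_neg j. *)
Record singular_data (R : realType) (n nu mu k : nat) := SingularData {
  sd_sigma : 'rV[R]_nu;
  sd_U : 'M[R[i]]_(n, nu);
  sd_V : 'M[R[i]]_(n, nu);
  sd_Ut : 'M[R[i]]_(n, mu);
  sd_Vt : 'M[R[i]]_(n, mu);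
  sd_Uh : 'M[R[i]]_(n, k);
  sd_neg : 'I_k -> bool
}.

Definition sd_signedUh (R : realType) (n nu mu k : nat)
    (d : singular_data R n nu mu k) : 'M[R[i]]_(n, k) :=
  \matrix_(i, j) ((-1) ^+ sd_neg d j * sd_Uh d i j).

(* The data d are singular values and vectors of A: they are read off, at
   pairwise distinct positions idx, from some SVD of A. Every singular value
   greater than 1 is listed; those smaller than 1 are not mentioned. *)
Definition has_singular_data (R : realType) (n nu mu k : nat)
    (A : 'M[R[i]]_n) (d : singular_data R n nu mu k) : Prop :=
  [/\ (k + 2 * nu + 2 * mu)%N = n,
      forall j, 1 < sd_sigma d 0 j,
      forall i j : 'I_nu, (i <= j)%N -> sd_sigma d 0 j <= sd_sigma d 0 i,
      forall j, col j (sd_Ut d) <> col j (sd_Vt d) /\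
                col j (sd_Ut d) <> - col j (sd_Vt d)
    & exists (U : 'M[R[i]]_n) (S : 'M[R]_n) (V : 'M[R[i]]_n)
        (idx : 'I_nu + ('I_mu + 'I_mu + 'I_k) -> 'I_n),
        is_svd A U S V /\ injective idx /\
        [/\ forall x, 1 < S x x -> exists j, x = idx (inl j),
            forall j, triplet_at U S V (idx (inl j))
              (col j (sd_U d)) (col j (sd_V d)) (sd_sigma d 0 j),
            forall j, triplet_at U S V (idx (inr (inl (inl j))))
              (col j (sd_Ut d)) (col j (sd_Vt d)) 1,
            forall j, triplet_at U S V (idx (inr (inl (inr j))))
              (col j (sd_Vt d)) (col j (sd_Ut d)) 1
          & forall j, triplet_at U S V (idx (inr (inr j)))
              (col j (sd_Uh d)) (col j (sd_signedUh d)) 1]].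

Definition dsum_mx (R : realType) (p q : nat) (A : 'M[R]_p) (B : 'M[R]_q) :
  'M[R]_(p + q) := block_mx A 0 0 B.

Definition sigma_mx (R : realType) (nu mu delta eta : nat) (s : 'rV[R]_nu) :
    'M[R]_(nu + (mu + (delta + (nu + (mu + eta))))) :=
  let S := diag_mx s in
  dsum_mx S (dsum_mx (1%:M : 'M_mu) (dsum_mx (1%:M : 'M_delta)
    (dsum_mx (invmx S) (dsum_mx (1%:M : 'M_mu) (1%:M : 'M_eta))))).

Definition cols6 (R : realType) (n nu mu delta eta : nat)
    (B1 : 'M[R[i]]_(n, nu)) (B2 : 'M[R[i]]_(n, mu)) (B3 : 'M[R[i]]_(n, delta))
    (B4 : 'M[R[i]]_(n, nu)) (B5 : 'M[R[i]]_(n, mu)) (B6 : 'M[R[i]]_(n, eta)) :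
    'M[R[i]]_(n, nu + (mu + (delta + (nu + (mu + eta))))) :=
  row_mx B1 (row_mx B2 (row_mx B3 (row_mx B4 (row_mx B5 B6)))).

Definition left_mx (R : realType) (n nu mu k delta eta : nat)
    (d : singular_data R n nu mu k) (ek : k = (delta + eta)%N) :=
  let Uh := castmx (erefl n, ek) (sd_Uh d) in
  cols6 (sd_U d) (sd_Ut d) (lsubmx Uh) (sd_V d) (sd_Vt d) (rsubmx Uh).

Definition right_mx (R : realType) (n nu mu k delta eta : nat)
    (d : singular_data R n nu mu k) (ek : k = (delta + eta)%N) :=
  let Uh := castmx (erefl n, ek) (sd_signedUh d) in
  cols6 (sd_V d) (sd_Vt d) (lsubmx Uh) (sd_U d) (sd_Ut d) (rsubmx Uh).

(* Main.v *)
Require Import Defs.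
From mathcomp Require Import all_boot all_order all_algebra.
From mathcomp Require Import reals complex.
From mathcomp Require Import zify.
Import Order.TTheory GRing.Theory Num.Theory.
Local Open Scope ring_scope.
Set Implicit Arguments.
Unset Strict Implicit.
Unset Printing Implicit Defensive.
Local Open Scope sesquilinear_scope.

(** Let [P] be the Gram matrix [A ^t* *m A]. Because [A] is involutory,
    [A *m A ^t*] is the inverse of [P] and [P *m A *m P = A]; so [A] maps an
    eigenvector of [P] for [a] to an eigenvector for [a^-1]: [gram_flip]. Hence
    a right singular vector [v] for a singular value [s > 1] and the left one,
    [u = s^-1 *: (A *m v)], are eigenvectors of the Hermitian matrix [P] for
    the distinct eigenvalues [s ^+ 2] and [s ^- 2], and both are orthogonal to
    the eigenspace of [P] for 1. This orthogonality, [mirror_orthonormal],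
    carries the whole proof.

    Given singular data, the vectors [u_j], [u~_j], [v~_j], [u^_j] and [v_j]
    are therefore orthonormal, and by their number they form a basis. [A] maps
    [v_j] to [s_j *: u_j], hence [u_j] to [s_j^-1 *: v_j], and similarly for the
    other triplets. The right vectors are the left ones permuted, up to signs,
    so they are orthonormal as well, and [A *m V = U *m S] is the decomposition
    [A = U *m S *m V ^t*] for every common ordering of the columns:
    [svd_of_adapted]. The displayed matrices use one particular ordering.

    Singular data exist. Take an orthonormal eigenbasis of [P], sort the
    eigenvectors with singular value above 1, and add their images. There are as
    many singular values above 1 as below: an orthonormal family built from
    either kind, from its images, and from the eigenvectors for 1 has at most
    [n] members, and the two resulting inequalities sum to an equality. On the
    eigenspace of [P] for 1 the involution [A] is unitary, hence Hermitian, and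
    it is diagonalized there with eigenvalues 1 and -1: [gram1_basis]. These
    eigenvalues are the signs of the single singular values, and a diagonal
    matrix with entries 1 and -1 shows that both signs may occur together. *)

(** * Orthonormal families of column vectors *)

Definition dot (C : numClosedFieldType) (n : nat) (u v : 'cV[C]_n) : C :=
  (u ^t* *m v) 0 0.

Lemma dotE (C : numClosedFieldType) (n : nat) (u v : 'cV[C]_n) :
  dot u v = \sum_i (u i 0)^* * v i 0.
Proof. by rewrite /dot mxE; apply: eq_bigr => i _; rewrite !mxE. Qed.

Lemma dotC (C : numClosedFieldType) (n : nat) (u v : 'cV[C]_n) :
  (dot u v)^* = dot v u.
Proof.
rewrite !dotE rmorph_sum; apply: eq_bigr => i _.
by rewrite rmorphM /= conjCK mulrC.
Qed.

Lemma dotZr (C : numClosedFieldType) (n : nat) (a : C) (u v : 'cV[C]_n) :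
  dot u (a *: v) = a * dot u v.
Proof. by rewrite /dot -scalemxAr mxE. Qed.

Lemma dotZl (C : numClosedFieldType) (n : nat) (a : C) (u v : 'cV[C]_n) :
  dot (a *: u) v = a^* * dot u v.
Proof. by rewrite -[LHS]dotC dotZr rmorphM /= dotC. Qed.

Lemma dot_adjoint (C : numClosedFieldType) (m n : nat) (M : 'M[C]_(m, n)) u v :
  dot (M *m u) v = dot u (M ^t* *m v).
Proof. by rewrite /dot trmx_mul map_mxM mulmxA. Qed.

Lemma dot_ge0 (C : numClosedFieldType) (n : nat) (u : 'cV[C]_n) : 0 <= dot u u.
Proof. by rewrite dotE sumr_ge0 // => i _; rewrite mulrC mul_conjC_ge0. Qed.

Lemma dot_col (C : numClosedFieldType) (m n p : nat) (M : 'M[C]_(m, n))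
    (N : 'M[C]_(m, p)) i j :
  dot (col i M) (col j N) = (M ^t* *m N) i j.
Proof. by rewrite dotE mxE; apply: eq_bigr => l _; rewrite !mxE. Qed.

(** Families indexed by an arbitrary finite type, because the singular vectors
   come in several blocks that are most naturally indexed by a sum type. *)
Definition orthonormal_family (C : numClosedFieldType) (n : nat) (T : finType)
    (g : T -> 'cV[C]_n) : Prop :=
  forall s t, dot (g s) (g t) = (s == t)%:R.

Definition cols_mx (C : numClosedFieldType) (n p : nat) (g : 'I_p -> 'cV[C]_n) :
  'M[C]_(n, p) := \matrix_(i, j) g j i 0.

Lemma col_cols_mx (C : numClosedFieldType) (n p : nat) (g : 'I_p -> 'cV[C]_n) j :
  col j (cols_mx g) = g j.
Proof. by apply/colP=> i; rewrite !mxE. Qed.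

Lemma orthonormal_comp (C : numClosedFieldType) (n : nat) (S T : finType)
    (g : T -> 'cV[C]_n) (f : S -> T) :
  injective f -> orthonormal_family g -> orthonormal_family (g \o f).
Proof. by move=> fI og s t; rewrite /= og (inj_eq fI). Qed.

Lemma orthonormal_cols (C : numClosedFieldType) (n p : nat)
    (g : 'I_p -> 'cV[C]_n) :
  orthonormal_family g -> (cols_mx g) ^t* *m cols_mx g = 1%:M.
Proof.
by move=> og; apply/matrixP=> i j; rewrite -dot_col !col_cols_mx og mxE.
Qed.

Lemma orthonormal_unitary (C : numClosedFieldType) (n : nat)
    (g : 'I_n -> 'cV[C]_n) :
  orthonormal_family g -> cols_mx g \is unitarymx.
Proof. by move/orthonormal_cols/mulmx1C/unitarymxP. Qed.

Lemma unitary_orthonormal (C : numClosedFieldType) (n : nat) (U : 'M[C]_n) :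
  U \is unitarymx -> orthonormal_family (fun j => col j U).
Proof. by move/unitarymxP/mulmx1C => UU i j; rewrite dot_col UU mxE. Qed.

Lemma orthonormal_card (C : numClosedFieldType) (n : nat) (T : finType)
    (g : T -> 'cV[C]_n) :
  orthonormal_family g -> (#|T| <= n)%N.
Proof.
move=> og; have := orthonormal_cols (orthonormal_comp (@enum_val_inj _ T) og).
set M := cols_mx _ => MM.
have uM : M ^t* \is unitarymx by apply/unitarymxP; rewrite trmxCK.
by rewrite -(mxrank_unitary uM) rank_leq_col.
Qed.

(** An orthonormal family of [n] vectors is a basis, so only zero is orthogonal
   to all of it. *)
Lemma orthonormal_total (C : numClosedFieldType) (n p : nat)
    (g : 'I_n -> 'cV[C]_n) (Z : 'M[C]_(n, p)) :
  orthonormal_family g -> (forall i j, dot (g i) (col j Z) = 0) -> Z = 0.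
Proof.
move=> og gZ; have GZ : (cols_mx g) ^t* *m Z = 0.
  by apply/matrixP=> i j; rewrite -dot_col col_cols_mx gZ mxE.
have /mulmx1C GG := orthonormal_cols og.
by rewrite -[Z]mul1mx -GG -mulmxA GZ mulmx0.
Qed.

Lemma isometry_orthonormal (C : numClosedFieldType) (m n : nat) (T : finType)
    (M : 'M[C]_(n, m)) (q : T -> 'cV[C]_m) :
  M ^t* *m M = 1%:M -> orthonormal_family q ->
  orthonormal_family (fun t => M *m q t).
Proof. by move=> MM oq s t; rewrite dot_adjoint mulmxA MM mul1mx oq. Qed.

(** * The Gram matrix of an involutory matrix *)

(** Its eigenvectors are the right singular vectors of [A], with eigenvalues
   the squared singular values. *)
Definition gram (C : numClosedFieldType) (n : nat) (A : 'M[C]_n) : 'M[C]_n :=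
  A ^t* *m A.

Lemma gram_adjoint (C : numClosedFieldType) (n : nat) (A : 'M[C]_n) :
  (gram A) ^t* = gram A.
Proof. by rewrite /gram trmx_mul map_mxM trmxCK. Qed.

Lemma dot_image (C : numClosedFieldType) (n : nat) (A : 'M[C]_n) u v :
  dot (A *m u) (A *m v) = dot u (gram A *m v).
Proof. by rewrite dot_adjoint mulmxA. Qed.

Lemma adjoint_involutory (C : numClosedFieldType) (n : nat) (A : 'M[C]_n) :
  A *m A = 1%:M -> A ^t* *m A ^t* = 1%:M.
Proof. by move=> AA; rewrite -map_mxM -trmx_mul AA trmx1 map_mx1. Qed.

(** Since [A] is its own inverse, multiplying [gram A] by [A] on the right
   cancels one factor. *)
Lemma gram_involutory (C : numClosedFieldType) (n : nat) (A : 'M[C]_n) :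
  A *m A = 1%:M -> gram A *m A = A ^t*.
Proof. by move=> AA; rewrite /gram -mulmxA AA mulmx1. Qed.

(** The source of the pairing of singular values with their inverses: from
   [gram A *m v = a *: v] and the involutivity of [A ^t*] one gets
   [A *m v = a *: (A ^t* *m v)], and [gram A *m A = A ^t*]. *)
Lemma gram_flip (C : numClosedFieldType) (n : nat) (A : 'M[C]_n)
    (v : 'cV[C]_n) (a : C) :
  A *m A = 1%:M -> a != 0 -> gram A *m v = a *: v ->
  gram A *m (A *m v) = a^-1 *: (A *m v).
Proof.
move=> AA a0 Pv; have AHv : A *m v = a *: (A ^t* *m v).
  by rewrite scalemxAr -Pv /gram !mulmxA adjoint_involutory // mul1mx.
by rewrite mulmxA gram_involutory // AHv scalerA mulVf // scale1r.
Qed.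

Lemma gram_eigen_orth (C : numClosedFieldType) (n : nat) (A : 'M[C]_n)
    (u v : 'cV[C]_n) (a b : C) :
  a \is Num.real -> gram A *m u = a *: u -> gram A *m v = b *: v -> a != b ->
  dot u v = 0.
Proof.
move=> ra Pu Pv ab; have : dot (gram A *m u) v = dot u (gram A *m v).
  by rewrite dot_adjoint gram_adjoint.
rewrite Pu Pv dotZl dotZr (conj_Creal ra) => /eqP.
by rewrite -subr_eq0 -mulrBl mulf_eq0 subr_eq0 (negPf ab) => /eqP.
Qed.

(** The family [v] of right singular vectors with singular values [s], the
   corresponding left singular vectors, and in between further vectors [w]
   meant for the singular value 1. The image of [v i] under [A] is again an
   eigenvector of [gram A], hence the name. *)
Definition mirror (C : numClosedFieldType) (n : nat) (I J : finType)
    (A : 'M[C]_n) (s : I -> C) (v : I -> 'cV[C]_n) (w : J -> 'cV[C]_n)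
    (t : I + J + I) : 'cV[C]_n :=
  match t with
  | inl (inl i) => (s i)^-1 *: (A *m v i)
  | inl (inr j) => w j
  | inr i => v i
  end.

(** The three blocks belong to the eigenvalues [(s i)^-2], [1] and [(s i)^+2]
   of [gram A], which never coincide between blocks as soon as no product
   [s i * s j] is 1. This one fact is used to count singular values, to
   construct singular data and to analyse given singular data. *)
Lemma mirror_orthonormal (C : numClosedFieldType) (n : nat) (I J : finType)
    (A : 'M[C]_n) (s : I -> C) (v : I -> 'cV[C]_n) (w : J -> 'cV[C]_n) :
  A *m A = 1%:M -> (forall i, 0 < s i) -> (forall i j, s i * s j != 1) ->
  orthonormal_family v -> (forall i, gram A *m v i = s i ^+ 2 *: v i) ->
  orthonormal_family w -> (forall j, gram A *m w j = w j) ->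
  orthonormal_family (mirror A s v w).
Proof.
move=> AA s0 s1 ov Pv ow Pw.
have s_neq0 i : s i != 0 by rewrite gt_eqF.
have sr i : s i ^+ 2 \is Num.real by rewrite rpredX // gtr0_real.
have svr i : (s i ^+ 2)^-1 \is Num.real by rewrite rpredV.
(* [s i * s j = -1] is excluded by positivity. *)
have sq1 i j : (s i ^+ 2)^-1 != s j ^+ 2.
  apply: contra (s1 i j) => /eqP e; have : (s i * s j) ^+ 2 == 1.
    by rewrite exprMn -e mulfV // expf_neq0.
  rewrite sqrf_eq1 => /orP[//|/eqP e']; have := mulr_gt0 (s0 i) (s0 j).
  by rewrite e' oppr_gt0 ltr10.
have s2 i : s i ^+ 2 != 1.
  by apply: contra (sq1 i i) => /eqP ->; rewrite invr1.
have Pu i : gram A *m ((s i)^-1 *: (A *m v i))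
    = (s i ^+ 2)^-1 *: ((s i)^-1 *: (A *m v i)).
  rewrite -scalemxAr (gram_flip AA (expf_neq0 2 (s_neq0 i)) (Pv i)).
  by rewrite !scalerA mulrC.
have Pw1 j : gram A *m w j = 1 *: w j by rewrite scale1r.
have uw i j : dot ((s i)^-1 *: (A *m v i)) (w j) = 0.
  by apply: (gram_eigen_orth (svr i) (Pu i) (Pw1 j)); rewrite invr_eq1.
have vw i j : dot (v i) (w j) = 0.
  exact: (gram_eigen_orth (sr i) (Pv i) (Pw1 j)).
have uv i j : dot ((s i)^-1 *: (A *m v i)) (v j) = 0.
  exact: (gram_eigen_orth (svr i) (Pu i) (Pv j)).
have sym x y : dot x y = 0 -> dot y x = 0 :> C.
  by rewrite -[dot y x]dotC => ->; rewrite conjC0.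
move=> [[i|j]|i] [[i'|j']|i'] //=; rewrite ?uw ?vw ?uv ?ow ?ov //; try exact: sym.
rewrite -[RHS]/(i == i')%:R dotZl dotZr dot_image Pv dotZr ov.
have [->|_] := eqVneq i i'; last by rewrite !mulr0.
rewrite conj_Creal ?rpredV ?gtr0_real // mulr1 expr2 !mulrA.
by rewrite -[_^-1 / _ * _]mulrA mulVf // mulr1 mulVf.
Qed.

(** * Orthonormal eigenbases *)

Lemma col_mulmx (K : pzSemiRingType) (m n p : nat) (M : 'M[K]_(m, n))
    (N : 'M[K]_(n, p)) j :
  col j (M *m N) = M *m col j N.
Proof. by apply/colP=> i; rewrite !mxE; apply: eq_bigr => l _; rewrite !mxE. Qed.

Lemma hermitian_eigenbasis (R : realType) (n : nat) (H : 'M[R[i]%C]_n) :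
  H ^t* = H ->
  exists (v : 'I_n -> 'cV[R[i]%C]_n) (d : 'I_n -> R),
    orthonormal_family v /\ forall i, H *m v i = ((d i)%:C)%C *: v i.
Proof.
move=> hH; have Hs : H \is hermsymmx by apply/is_hermitianmxP; rewrite scale1r hH.
have /orthomx_spectralP HE := hermitian_normalmx Hs.
have /mxOverP dR := hermitian_spectral_diag_real Hs.
have uW := spectral_unitarymx H.
exists (fun j => col j ((spectralmx H) ^t*)).
exists (fun j => complex.Re (spectral_diag H 0 j)).
split=> [|j]; first by apply: unitary_orthonormal; rewrite trmxC_unitary.
rewrite RRe_real // -col_mulmx {1}HE invmx_unitary // -!mulmxA.
rewrite (unitarymxP uW) mulmx1 mul_mx_diag.
by apply/colP=> i; rewrite !mxE mulrC.
Qed.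

(** The eigenvalues of [gram A] are nonnegative because
   [dot v (gram A *m v)] is the squared norm of [A *m v], and nonzero because
   [gram A] is invertible; [s] lists their square roots. *)
Lemma singular_basis (R : realType) (n : nat) (A : 'M[R[i]%C]_n) :
  A *m A = 1%:M ->
  exists (v : 'I_n -> 'cV[R[i]%C]_n) (s : 'I_n -> R),
    [/\ orthonormal_family v, forall i, 0 < s i
      & forall i, gram A *m v i = ((s i)%:C)%C ^+ 2 *: v i].
Proof.
move=> AA; have [v [d [ov Pv]]] := hermitian_eigenbasis (gram_adjoint A).
have d0 i : 0 < d i.
  rewrite lt_neqAle; apply/andP; split; last first.
    have := dot_ge0 (A *m v i).
    by rewrite dot_image Pv dotZr ov eqxx mulr1 ler0c.
  apply/eqP => d0; have := ov i i; rewrite eqxx.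
  (* [A *m A ^t*] is the inverse of [gram A]. *)
  have -> : v i = A *m A ^t* *m (gram A *m v i).
    rewrite /gram !mulmxA -[A *m _ *m _]mulmxA adjoint_involutory //.
    by rewrite mulmx1 AA mul1mx.
  rewrite Pv -d0 scale0r mulmx0 /dot mulmx0 mxE => /eqP.
  by rewrite eq_sym oner_eq0.
exists v, (fun i => Num.sqrt (d i)); split=> // i; first by rewrite sqrtr_gt0.
by rewrite Pv -rmorphXn /= sqr_sqrtr // ltW.
Qed.

(** * The vectors listed by singular data *)

(** The indices of the singular vectors in the order of the positions used by
   [has_singular_data], followed by a second copy of ['I_nu] for the partners
   belonging to the singular values below 1. *)
Definition data_index (nu mu k : nat) : finType :=
  (('I_nu + ('I_mu + 'I_mu + 'I_k)) + 'I_nu)%type.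

Section DataVectors.
Context (R : realType) (n nu mu k : nat) (d : singular_data R n nu mu k).

Definition left_vec (t : data_index nu mu k) : 'cV[R[i]%C]_n :=
  match t with
  | inl (inl j) => col j (sd_U d)
  | inl (inr (inl (inl j))) => col j (sd_Ut d)
  | inl (inr (inl (inr j))) => col j (sd_Vt d)
  | inl (inr (inr j)) => col j (sd_Uh d)
  | inr j => col j (sd_V d)
  end.

Definition right_vec (t : data_index nu mu k) : 'cV[R[i]%C]_n :=
  match t with
  | inl (inl j) => col j (sd_V d)
  | inl (inr (inl (inl j))) => col j (sd_Vt d)
  | inl (inr (inl (inr j))) => col j (sd_Ut d)
  | inl (inr (inr j)) => col j (sd_signedUh d)
  | inr j => col j (sd_U d)
  end.

Definition sing_val (t : data_index nu mu k) : R :=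
  match t with
  | inl (inl j) => sd_sigma d 0 j
  | inl (inr _) => 1
  | inr j => (sd_sigma d 0 j)^-1
  end.

(** The involution exchanging a triplet [(u, v, s)] with [(v, u, 1 / s)];
   a single singular value 1 is its own partner, up to the sign. *)
Definition swap (t : data_index nu mu k) : data_index nu mu k :=
  match t with
  | inl (inl j) => inr j
  | inl (inr (inl (inl j))) => inl (inr (inl (inr j)))
  | inl (inr (inl (inr j))) => inl (inr (inl (inl j)))
  | inl (inr (inr j)) => inl (inr (inr j))
  | inr j => inl (inl j)
  end.

Definition negated (t : data_index nu mu k) : bool :=
  if t is inl (inr (inr j)) then sd_neg d j else false.

Lemma swapK : involutive swap.
Proof. by case=> [[j|[[j|j]|j]]|j]. Qed.

(** Up to signs, the right singular vectors are the left ones in another order;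
   therefore only the left ones have to be shown orthonormal. *)
Lemma right_vecE t : right_vec t = (-1) ^+ negated t *: left_vec (swap t).
Proof.
case: t => [[j|[[j|j]|j]]|j] /=; rewrite ?scale1r //.
by apply/colP=> i; rewrite !mxE.
Qed.

Lemma right_vec_orthonormal :
  orthonormal_family left_vec -> orthonormal_family right_vec.
Proof.
move=> ol s t; rewrite !right_vecE dotZl dotZr ol (inj_eq (can_inj swapK)).
have [->|_] := eqVneq s t; last by rewrite !mulr0.
by rewrite rmorph_sign mulr1 -signr_addb addbb.
Qed.

(** What remains of singular data once the positions in a particular
   decomposition are forgotten. Any enumeration of the index type then gives a
   decomposition with the columns in that order. *)
Definition adapted (A : 'M[R[i]%C]_n) : Prop :=
  [/\ forall j, 1 < sd_sigma d 0 j, orthonormal_family left_vec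
    & forall t, singular_triplet A (left_vec t) (right_vec t) (sing_val t)].

Lemma sing_val_gt0 t : (forall j, 1 < sd_sigma d 0 j) -> 0 < sing_val t.
Proof.
by move=> s1; case: t => [[j|j]|j] /=; rewrite ?invr_gt0 // (lt_trans _ (s1 j)).
Qed.

(** The triplets say [A *m V = U *m S], and [V] is unitary. *)
Lemma svd_of_adapted (A : 'M[R[i]%C]_n) (tau : 'I_n -> data_index nu mu k) :
  adapted A -> injective tau ->
  is_svd A (cols_mx (left_vec \o tau)) (diag_mx (\row_j sing_val (tau j)))
    (cols_mx (right_vec \o tau)).
Proof.
move=> [s1 ol Ar] tau_inj; have orr := right_vec_orthonormal ol.
have uV := orthonormal_unitary (orthonormal_comp tau_inj orr).
split; first exact: orthonormal_unitary (orthonormal_comp tau_inj ol).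
- by [].
- exact: diag_mx_is_diag.
- by move=> i; rewrite !mxE eqxx ltW // sing_val_gt0.
rewrite map_diag_mx mul_mx_diag -[LHS]mulmx1.
have <- := mulmx1C (orthonormal_cols (orthonormal_comp tau_inj orr)).
rewrite mulmxA; congr (_ *m _).
apply/matrixP=> i j.
have /colP/(_ i) := Ar (tau j).
have -> : A *m right_vec (tau j) = col j (A *m cols_mx (right_vec \o tau)).
  by rewrite col_mulmx col_cols_mx.
by rewrite !mxE mulrC.
Qed.

(** The left vectors form a [mirror] family, because [u_j] is [A *m v_j] divided
   by the singular value, and products of numbers above 1 are above 1. *)
Lemma left_vec_orthonormal (A : 'M[R[i]%C]_n) :
  A *m A = 1%:M -> (forall j, 1 < sd_sigma d 0 j) ->
  orthonormal_family (fun j => col j (sd_V d)) ->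
  (forall j, gram A *m col j (sd_V d)
             = ((sd_sigma d 0 j)%:C)%C ^+ 2 *: col j (sd_V d)) ->
  (forall j, A *m col j (sd_V d) = ((sd_sigma d 0 j)%:C)%C *: col j (sd_U d)) ->
  orthonormal_family (fun x => left_vec (inl (inr x))) ->
  (forall x, gram A *m left_vec (inl (inr x)) = left_vec (inl (inr x))) ->
  orthonormal_family left_vec.
Proof.
move=> AA s1 oV PV AV ow Pw.
have s0 j : 0 < ((sd_sigma d 0 j)%:C)%C :> R[i]%C.
  by rewrite ltcR (lt_trans _ (s1 j)).
have ss i j : ((sd_sigma d 0 i)%:C)%C * ((sd_sigma d 0 j)%:C)%C != 1 :> R[i]%C.
  rewrite -rmorphM /= -[1](rmorph1 (real_complex R)) (inj_eq (@complexI _)).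
  by rewrite gt_eqF // mulr_egt1.
have om := mirror_orthonormal AA s0 ss oV PV ow Pw.
have E t : left_vec t = mirror A (fun j => ((sd_sigma d 0 j)%:C)%C)
    (fun j => col j (sd_V d)) (fun x => left_vec (inl (inr x))) t.
  case: t => [[j|x]|j] //=.
  by rewrite AV scalerA mulVf ?scale1r // gt_eqF.
by move=> s t; rewrite !E om.
Qed.

End DataVectors.

(** * Singular data versus adapted data *)

Lemma svd_triplets (R : realType) (n : nat) (A U : 'M[R[i]%C]_n) (S : 'M[R]_n)
    (V : 'M[R[i]%C]_n) (x : 'I_n) :
  is_svd A U S V ->
  A *m col x V = ((S x x)%:C)%C *: col x U /\
  A ^t* *m col x U = ((S x x)%:C)%C *: col x V.
Proof.
case=> uU uV /diag_mxP[s ->] _ ->; rewrite map_diag_mx mxE eqxx mulr1n.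
have /mulmx1C UU := unitarymxP uU; have /mulmx1C VV := unitarymxP uV.
split; rewrite -col_mulmx.
  rewrite -!mulmxA VV mulmx1 mul_mx_diag.
  by apply/colP=> i; rewrite !mxE mulrC.
rewrite !trmx_mul !map_mxM trmxCK tr_diag_mx map_diag_mx.
rewrite -!mulmxA UU mulmx1 mul_mx_diag.
apply/colP=> i; rewrite !mxE mulrC; congr (_ * _); apply: conj_Creal.
by apply/complex_realP; exists (s 0 x).
Qed.

(** The given decomposition provides the right singular vectors [v_j] and the
   vectors for the singular value 1 as columns of its two unitary matrices.
   That the [v_j] are orthogonal to the chosen columns of [U], and the triplet
   [(v_j, u_j, 1 / s_j)], both come from [A] being involutory. *)
Lemma adapted_of_singular_data (R : realType) (n nu mu k : nat)
    (A : 'M[R[i]%C]_n) (d : singular_data R n nu mu k) :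
  A *m A = 1%:M -> has_singular_data A d -> adapted d A.
Proof.
move=> AA [_ s1 _ _ [U [S [V [idx [svd [idx_inj [_ tU tUt tVt tUh]]]]]]]].
have [uU uV _ _ _] := svd.
have idxP x : triplet_at U S V (idx x) (left_vec d (inl x)) (right_vec d (inl x))
    (sing_val d (inl x)).
  by case: x => [j|[[j|j]|j]].
have oV : orthonormal_family (fun j => col j (sd_V d)).
  move=> i j; have [_ <- _] := tU i; have [_ <- _] := tU j.
  by rewrite (unitary_orthonormal uV) (inj_eq idx_inj).
have ow : orthonormal_family (fun x => left_vec d (inl (inr x))).
  move=> x y; have [<- _ _] := idxP (inr x); have [<- _ _] := idxP (inr y).
  by rewrite (unitary_orthonormal uU) (inj_eq idx_inj).
have Ainl x : A *m right_vec d (inl x)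
    = ((sing_val d (inl x))%:C)%C *: left_vec d (inl x).
  by have [<- <- <-] := idxP x; have [] := svd_triplets (idx x) svd.
have AHinl x : A ^t* *m left_vec d (inl x)
    = ((sing_val d (inl x))%:C)%C *: right_vec d (inl x).
  by have [<- <- <-] := idxP x; have [] := svd_triplets (idx x) svd.
have PV j : gram A *m col j (sd_V d)
    = ((sd_sigma d 0 j)%:C)%C ^+ 2 *: col j (sd_V d).
  have /= Av := Ainl (inl j); have /= AHu := AHinl (inl j).
  by rewrite /gram -mulmxA Av -scalemxAr AHu scalerA.
have Pw x : gram A *m left_vec d (inl (inr x)) = left_vec d (inl (inr x)).
  have Av : A *m right_vec d (inl (inr x)) = left_vec d (inl (inr x)).
    by rewrite Ainl; apply: scale1r.
  have AHu : A ^t* *m left_vec d (inl (inr x)) = right_vec d (inl (inr x)).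
    by rewrite AHinl; apply: scale1r.
  rewrite /gram -mulmxA -{1}Av [A *m (A *m _)]mulmxA AA mul1mx.
  by rewrite -AHu mulmxA adjoint_involutory // mul1mx.
split=> //.
  by apply: (left_vec_orthonormal AA s1 oV PV) ow Pw => j; apply: (Ainl (inl j)).
case=> [x|j]; first exact: Ainl.
rewrite /singular_triplet /=.
have /= Av := Ainl (inl j).
have -> : col j (sd_V d) = ((sd_sigma d 0 j)%:C)%C *: (A *m col j (sd_U d)).
  by rewrite scalemxAr -Av mulmxA AA mul1mx.
rewrite scalerA -rmorphM /= mulVf ?scale1r // gt_eqF //.
exact: lt_trans (s1 j).
Qed.

(** The enumeration of the index type, which has [n] elements, serves as the
   list of positions. Only the first block has singular values above 1. *)
Lemma singular_data_of_adapted (R : realType) (n nu mu k : nat)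
    (A : 'M[R[i]%C]_n) (d : singular_data R n nu mu k) :
  adapted d A -> (k + 2 * nu + 2 * mu)%N = n ->
  (forall i j : 'I_nu, (i <= j)%N -> sd_sigma d 0 j <= sd_sigma d 0 i) ->
  (forall j, col j (sd_Ut d) <> col j (sd_Vt d) /\
             col j (sd_Ut d) <> - col j (sd_Vt d)) ->
  has_singular_data A d.
Proof.
move=> ad kn dec neq; have [s1 _ _] := ad; split=> //.
have cT : #|data_index nu mu k| = n.
  by rewrite /data_index !card_sum !card_ord; lia.
pose tau (i : 'I_n) : data_index nu mu k := enum_val (cast_ord (esym cT) i).
pose pos t := cast_ord cT (enum_rank t).
have posK : cancel pos tau by move=> t; rewrite /tau /pos cast_ordK enum_rankK.
have tauK : cancel tau pos by move=> i; rewrite /tau /pos enum_valK cast_ordKV.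
have tri t : triplet_at (cols_mx (left_vec d \o tau))
    (diag_mx (\row_j sing_val d (tau j))) (cols_mx (right_vec d \o tau))
    (pos t) (left_vec d t) (right_vec d t) (sing_val d t).
  by split; rewrite ?col_cols_mx /= ?posK // !mxE eqxx posK.
exists (cols_mx (left_vec d \o tau)), (diag_mx (\row_j sing_val d (tau j))).
exists (cols_mx (right_vec d \o tau)), (pos \o inl).
split; first exact: svd_of_adapted (can_inj tauK).
split; first by apply: inj_comp (can_inj posK) _ => x y [].
split=> [x| j | j | j | j]; last 4 first.
- exact: tri (inl (inl j)).
- exact: tri (inl (inr (inl (inl j)))).
- exact: tri (inl (inr (inl (inr j)))).
- exact: tri (inl (inr (inr j))).
rewrite !mxE eqxx mulr1n -{2}[x]tauK; case: (tau x) => [[j|j]|j] /= s_gt1.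
- by exists j.
- by rewrite ltxx in s_gt1.
by move: s_gt1; rewrite invf_gt1 ?(lt_trans _ (s1 j)) // ltNge ltW.
Qed.

(** * The displayed decomposition *)

(** The order of the columns in the displayed matrices: the block of [u_j] is
   completed by [u~_j] and the first [delta] vectors [u^_j], then come the
   partners and the remaining [u^_j]. *)
Definition block_index (nu mu delta eta : nat)
    (i : 'I_(nu + (mu + (delta + (nu + (mu + eta)))))) :
    data_index nu mu (delta + eta) :=
  match split i with
  | inl j => inl (inl j)
  | inr i => match split i with
    | inl j => inl (inr (inl (inl j)))
    | inr i => match split i with
      | inl j => inl (inr (inr (lshift eta j)))
      | inr i => match split i with
        | inl j => inr j
        | inr i => match split i with
          | inl j => inl (inr (inl (inr j)))
          | inr j => inl (inr (inr (rshift delta j)))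
          end
        end
      end
    end
  end.

Lemma block_index_inj (nu mu delta eta : nat) :
  injective (@block_index nu mu delta eta).
Proof.
(* [pos] is a left inverse: the position of a vector in the displayed order. *)
pose pos (t : data_index nu mu (delta + eta)) :
    'I_(nu + (mu + (delta + (nu + (mu + eta))))) :=
  match t with
  | inl (inl j) => lshift _ j
  | inl (inr (inl (inl j))) => rshift _ (lshift _ j)
  | inl (inr (inl (inr j))) =>
      rshift _ (rshift _ (rshift _ (rshift _ (lshift _ j))))
  | inl (inr (inr j)) => match split j with
    | inl j => rshift _ (rshift _ (lshift _ j))
    | inr j => rshift _ (rshift _ (rshift _ (rshift _ (rshift _ j))))
    end
  | inr j => rshift _ (rshift _ (rshift _ (lshift _ j)))
  end.
apply: (can_inj (g := pos)) => i; rewrite /block_index.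
by do 5?[case: (split_ordP i) => {}i -> //=];
  rewrite ?(unsplitK (inl i)) ?(unsplitK (inr i)).
Qed.

Lemma svd_blocks (R : realType) (nu mu delta eta : nat)
    (A : 'M[R[i]%C]_(nu + (mu + (delta + (nu + (mu + eta))))))
    (d : singular_data R _ nu mu (delta + eta)) :
  adapted d A ->
  is_svd A (left_mx d erefl) (sigma_mx mu delta eta (sd_sigma d))
    (right_mx d erefl).
Proof.
move=> ad; have [s1 _ _] := ad.
have := svd_of_adapted ad (@block_index_inj nu mu delta eta).
set L := cols_mx _; set S := diag_mx _; set V := cols_mx _.
have -> : L = left_mx d erefl.
  apply/matrixP=> i j; rewrite !mxE /= /block_index.
  by do 5?[case: split => {}j; rewrite ?castmx_id !mxE //=].
have -> : V = right_mx d erefl.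
  apply/matrixP=> i j; rewrite !mxE /= /block_index.
  by do 5?[case: split => {}j; rewrite ?castmx_id !mxE //=].
have -> : S = sigma_mx mu delta eta (sd_sigma d); last by [].
have -> : sigma_mx mu delta eta (sd_sigma d) = diag_mx
    (row_mx (sd_sigma d) (row_mx (const_mx 1) (row_mx (const_mx 1)
      (row_mx (\row_j (sd_sigma d 0 j)^-1) (row_mx (const_mx 1) (const_mx 1)))))).
  have DD : diag_mx (sd_sigma d) *m diag_mx (\row_j (sd_sigma d 0 j)^-1) = 1%:M.
    rewrite mulmx_diag -diag_const_mx; congr diag_mx; apply/rowP=> j.
    by rewrite !mxE mulfV // gt_eqF // (lt_trans _ (s1 j)).
  have [uD _] := mulmx1_unit DD.
  have E : invmx (diag_mx (sd_sigma d)) = diag_mx (\row_j (sd_sigma d 0 j)^-1).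
    by rewrite -[LHS]mulmx1 -DD mulKmx.
  by rewrite /sigma_mx /dsum_mx E -!diag_const_mx -!diag_mx_row.
congr diag_mx; apply/rowP=> j; rewrite !mxE /block_index.
by do 5?[case: split => {}j; rewrite ?mxE //=].
Qed.

(** * Existence of singular data *)

(** On the eigenspace of [gram A] for the eigenvalue 1 the involution is
   unitary, hence also Hermitian. *)
Lemma adjoint_gram_fixed (C : numClosedFieldType) (n k : nat) (A : 'M[C]_n)
    (M : 'M[C]_(n, k)) :
  A *m A = 1%:M -> gram A *m M = M -> A ^t* *m M = A *m M.
Proof.
by move=> AA PM; rewrite -{1}PM /gram !mulmxA adjoint_involutory // mul1mx.
Qed.

(** The columns of [M] span the eigenspace of [gram A] for the eigenvalue 1,
   which [A] preserves; the last equation says that [A] acts on it by the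
   compressed matrix [M ^t* *m A *m M]. *)
Lemma gram1_stable (R : realType) (n k : nat) (A : 'M[R[i]%C]_n)
    (v : 'I_n -> 'cV[R[i]%C]_n) (s : 'I_n -> R) (h : 'I_k -> 'I_n) :
  A *m A = 1%:M -> orthonormal_family v -> (forall i, 0 < s i) ->
  (forall i, gram A *m v i = ((s i)%:C)%C ^+ 2 *: v i) ->
  injective h -> (forall i, s i = 1 <-> exists j, i = h j) ->
  let M := cols_mx (v \o h) in
  gram A *m M = M /\ A *m M = M *m (M ^t* *m A *m M).
Proof.
move=> AA ov s0 Pv h_inj hP M.
have MM : M ^t* *m M = 1%:M by apply: orthonormal_cols; apply: orthonormal_comp.
have PM : gram A *m M = M.
  have PMc j : gram A *m v (h j) = v (h j).
    by have [_ s1] := hP (h j); rewrite Pv s1 ?expr1n ?scale1r //; exists j.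
  apply/matrixP=> i j; have /colP/(_ i) := PMc j.
  have -> : v (h j) = col j M by rewrite col_cols_mx.
  by rewrite -col_mulmx !mxE.
split=> //; apply/eqP; rewrite -subr_eq0; apply/eqP.
(* The defect [Z] again consists of fixed vectors of [gram A], hence is
   orthogonal to the [v i] with [s i != 1]; it is orthogonal to the others by
   construction, so it is orthogonal to a basis. *)
set Z := _ - _; have PZ : gram A *m Z = Z.
  rewrite /Z mulmxBr !mulmxA PM gram_involutory //; congr (_ - _).
  exact: adjoint_gram_fixed.
apply: (orthonormal_total ov) => i j.
have [si|si] := eqVneq (s i) 1.
  have [/(_ si)[l ->] _] := hP i.
  have -> : v (h l) = col l M by rewrite col_cols_mx.
  by rewrite dot_col mulmxBr !mulmxA MM mul1mx subrr mxE.
apply: (gram_eigen_orth _ (Pv i) (b := 1)).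
- by rewrite rpredX //; apply/complex_realP; exists (s i).
- by rewrite -col_mulmx PZ scale1r.
rewrite -rmorphXn -[1](rmorph1 (real_complex R)) (inj_eq (@complexI _)).
rewrite sqrf_eq1 (negPf si) /=; apply/eqP => e; have := s0 i.
by rewrite e oppr_gt0 ltr10.
Qed.

(** The compressed matrix is a Hermitian involution, so it has an orthonormal
   eigenbasis with eigenvalues 1 and -1; this is where the single singular
   values with their signs come from. *)
Lemma gram1_basis (R : realType) (n k : nat) (A : 'M[R[i]%C]_n)
    (M : 'M[R[i]%C]_(n, k)) :
  A *m A = 1%:M -> M ^t* *m M = 1%:M -> gram A *m M = M ->
  A *m M = M *m (M ^t* *m A *m M) ->
  exists (q : 'I_k -> 'cV[R[i]%C]_n) (neg : 'I_k -> bool),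
    [/\ orthonormal_family q, forall j, gram A *m q j = q j
      & forall j, A *m q j = (-1) ^+ neg j *: q j].
Proof.
move=> AA MM PM; set B := M ^t* *m A *m M => AM.
have AHM := adjoint_gram_fixed AA PM.
have hB : B ^t* = B.
  by rewrite /B !trmx_mul !map_mxM trmxCK -mulmxA AHM mulmxA.
have BB : B *m B = 1%:M.
  by rewrite {1}/B -mulmxA -AM -mulmxA [A *m (A *m M)]mulmxA AA mul1mx.
have [x [d [ox Bx]]] := hermitian_eigenbasis hB.
(* [B] squares to the identity, so its real eigenvalues are signs. *)
have d1 j : d j = (-1) ^+ (d j == -1).
  have : x j = ((d j ^+ 2)%:C)%C *: x j.
    by rewrite rmorphXn expr2 -scalerA -Bx scalemxAr -Bx mulmxA BB mul1mx.
  move/(congr1 (dot (x j))); rewrite dotZr ox eqxx mulr1 => /complexI /esym /eqP.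
  rewrite sqrf_eq1 => /orP[]/eqP ->; last by rewrite eqxx.
  by rewrite gt_eqF // (lt_trans _ ltr01) // oppr_lt0.
exists (fun j => M *m x j), (fun j => d j == -1); split.
- exact: isometry_orthonormal.
- by move=> j; rewrite mulmxA PM.
move=> j; rewrite mulmxA AM -mulmxA Bx {1}d1 rmorphXn rmorphN1 /=.
by rewrite scalemxAr.
Qed.

(** Counting the members of an orthonormal [mirror] family. Applied to the
   singular values above 1 and to those below 1, it shows that there are
   equally many of both. *)
Lemma mirror_card (R : realType) (n p k : nat) (A : 'M[R[i]%C]_n)
    (v : 'I_n -> 'cV[R[i]%C]_n) (s : 'I_n -> R)
    (f : 'I_p -> 'I_n) (h : 'I_k -> 'I_n) :
  A *m A = 1%:M -> orthonormal_family v -> (forall i, 0 < s i) ->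
  (forall i, gram A *m v i = ((s i)%:C)%C ^+ 2 *: v i) ->
  injective f -> (forall i j, s (f i) * s (f j) != 1) ->
  injective h -> (forall j, s (h j) = 1) ->
  (p + k + p <= n)%N.
Proof.
move=> AA ov s0 Pv f_inj sf h_inj sh.
have /orthonormal_card : orthonormal_family
    (mirror A (fun i => ((s (f i))%:C)%C) (v \o f) (v \o h)).
  apply: mirror_orthonormal => //.
  - by move=> i; rewrite ltcR.
  - move=> i j; rewrite -rmorphM -[1](rmorph1 (real_complex R)).
    by rewrite (inj_eq (@complexI _)).
  - exact: orthonormal_comp.
  - by move=> i; apply: Pv.
  - exact: orthonormal_comp.
  - by move=> j; rewrite /= Pv sh expr1n scale1r.
by rewrite !card_sum !card_ord.
Qed.

(** One may take [mu = 0]: the whole eigenspace for the singular value 1 has a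
   basis of eigenvectors of [A], which give single singular values. *)
Lemma exists_singular_data (R : realType) (n : nat) (A : 'M[R[i]%C]_n) :
  A *m A = 1%:M ->
  exists (nu mu k : nat) (d : singular_data R n nu mu k), has_singular_data A d.
Proof.
move=> AA; have [v [s [ov s0 Pv]]] := singular_basis AA.
pose h (j : 'I_#|[pred i | s i == 1]|) := enum_val j.
have h_inj : injective h := @enum_val_inj _ _.
have sh j : s (h j) = 1 by apply/eqP; have := enum_valP j.
pose g (j : 'I_#|[pred i | s i < 1]|) := enum_val j.
have g_inj : injective g := @enum_val_inj _ _.
have sg j : s (g j) < 1 by have := enum_valP j.
pose l := sort (fun i j => s j <= s i) (enum [pred i | 1 < s i]).
pose f (j : 'I_(size l)) := tnth (in_tuple l) j.
have sf j : 1 < s (f j).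
  by have := mem_tnth j (in_tuple l); rewrite mem_sort mem_enum.
have f_inj : injective f by apply/tuple_uniqP; rewrite sort_uniq enum_uniq.
have f_dec (i j : 'I_(size l)) : (i <= j)%N -> s (f j) <= s (f i).
  move=> ij; rewrite /f !(tnth_nth (f i)) /=.
  apply: (sorted_leq_nth (leT := fun i j => s j <= s i)) => //.
  - by move=> y x z xy yz; apply: le_trans yz xy.
  - rewrite /l; apply: sort_sorted => x y; apply: le_total.
  - by rewrite inE.
  - by rewrite inE.
have size_l : size l = #|[pred i | 1 < s i]| by rewrite size_sort cardE.
have nE : (size l + #|[pred i | (s i < 1)%R]| + #|[pred i | s i == 1%R]| = n)%N.
  rewrite size_l -[RHS]card_ord -(cardC [pred i | s i == 1]) addnC.
  congr (_ + _)%N.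
  rewrite -(cardID [pred i | 1 < s i] (predC _)); congr (_ + _)%N.
    by apply: eq_card => i; rewrite !inE; case: ltgtP.
  by apply: eq_card => i; rewrite !inE; case: ltgtP.
(* The numbers [a], [b], [c] of indices with [s i > 1], [< 1], [= 1] add up to
   [n] and satisfy [2 a + c <= n] and [2 b + c <= n]; hence [a = b]. *)
have c1 : (size l + #|[pred i | s i == 1%R]| + size l <= n)%N.
  apply: (mirror_card AA ov s0 Pv f_inj) h_inj sh => i j.
  by rewrite gt_eqF // mulr_egt1.
have c2 : (#|[pred i | (s i < 1)%R]| + #|[pred i | s i == 1%R]|
            + #|[pred i | (s i < 1)%R]| <= n)%N.
  apply: (mirror_card AA ov s0 Pv g_inj) h_inj sh => i j.
  by rewrite lt_eqF // mulr_ilt1 // ltW.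
have hP i : s i = 1 <-> exists j, i = h j.
  split=> [/eqP si|[j ->]//]; exists (enum_rank_in (A := [pred i | s i == 1]) si i).
  by rewrite /h enum_rankK_in.
have [PM AM] := gram1_stable AA ov s0 Pv h_inj hP.
have MM := orthonormal_cols (orthonormal_comp h_inj ov).
have [q [neg [oq Pq Aq]]] := gram1_basis AA MM PM AM.
pose u j := ((s (f j))%:C^-1)%C *: (A *m v (f j)).
exists (size l), 0%N, #|[pred i | s i == 1]|.
exists (SingularData (\row_j s (f j)) (cols_mx u) (cols_mx (v \o f)) 0 0
          (cols_mx q) neg).
set d := SingularData _ _ _ _ _ _ _.
have fr_neq0 j : (s (f j))%:C%C != 0 :> R[i]%C by rewrite gt_eqF // ltcR.
have Av j : A *m v (f j) = ((s (f j))%:C)%C *: u j.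
  by rewrite scalerA mulfV // scale1r.
have Au j : A *m u j = ((s (f j))^-1%:C)%C *: v (f j).
  by rewrite -scalemxAr mulmxA AA mul1mx fmorphV.
have s1 j : 1 < sd_sigma d 0 j by rewrite mxE.
have ow : orthonormal_family (fun x => left_vec d (inl (inr x))).
  move=> [[[//]|[//]]|x] [[[//]|[//]]|y].
  by rewrite /left_vec !col_cols_mx oq.
have Pw x : gram A *m left_vec d (inl (inr x)) = left_vec d (inl (inr x)).
  by case: x => [[[//]|[//]]|x]; rewrite /left_vec !col_cols_mx.
have ol : orthonormal_family (left_vec d).
  apply: (left_vec_orthonormal AA s1 _ _ _ ow Pw) => [i j|j|j].
  - by rewrite !col_cols_mx (orthonormal_comp f_inj ov).
  - by rewrite col_cols_mx mxE Pv.
  - by rewrite !col_cols_mx mxE -Av.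
apply: singular_data_of_adapted; last by case.
- split=> // -[[j|[[[//]|[//]]|j]]|j]; rewrite /singular_triplet /=.
  + by rewrite !col_cols_mx mxE -Av.
  + have -> : col j (sd_signedUh d) = (-1) ^+ neg j *: q j.
      by apply/colP=> i; rewrite !mxE.
    rewrite -scalemxAr Aq scalerA -signr_addb addbb !scale1r.
    by rewrite col_cols_mx.
  + by rewrite !col_cols_mx mxE Au.
- by rewrite -[RHS]nE; move: c1 c2 nE; lia.
by move=> i j ij; rewrite !mxE f_dec.
Qed.

(** * The theorem *)

(** The diagonal matrix with entries 1 and -1, with the standard basis as left
   singular vectors. *)
Lemma mixed_signs (R : realType) :
  exists (n : nat) (A : 'M[R[i]%C]_n) (nu mu k : nat)
     (d : singular_data R n nu mu k) (j j' : 'I_k),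
     [/\ involutory A, has_singular_data A d & sd_neg d j <> sd_neg d j'].
Proof.
pose neg (j : 'I_2) := j != 0.
pose A : 'M[R[i]%C]_2 := diag_mx (\row_j (-1) ^+ neg j).
pose d : singular_data R 2 0 0 2 := SingularData 0 0 0 0 0 1%:M neg.
exists 2%N, A, 0%N, 0%N, 2%N, d, 0, 1; split=> //.
  rewrite /involutory mulmx_diag -diag_const_mx; congr diag_mx; apply/rowP=> j.
  by rewrite !mxE -signr_addb addbb.
apply: singular_data_of_adapted => //; try by case.
split; first by case.
  move=> [[[]|[[[]|[]]|i]]|[]] // [[[]|[[[]|[]]|j]]|[]] //=.
  by rewrite dot_col trmx1 map_mx1 mul1mx mxE.
case=> [[[]|[[[]|[]]|j]]|[]] //; rewrite /singular_triplet /= scale1r.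
apply/colP=> i; rewrite mul_diag_mx !mxE.
case: eqP => [<-|_]; last by rewrite !mulr0.
by rewrite mulr1 -signr_addb addbb.
Qed.

Lemma displayed_svd (R : realType) (n nu mu k : nat) (A : 'M[R[i]%C]_n)
    (d : singular_data R n nu mu k) :
  adapted d A -> (k + 2 * nu + 2 * mu)%N = n ->
  exists (m delta eta : nat) (ek : k = (delta + eta)%N)
    (en : (nu + (mu + (delta + (nu + (mu + eta)))))%N = n),
    [/\ (nu + mu + eta)%N = m,
        (n = (2 * m)%N /\ delta = eta) \/
        (n = (2 * m + 1)%N /\ delta = (eta + 1)%N)
      & is_svd A
          (castmx (erefl n, en) (left_mx d ek))
          (castmx (en, en) (sigma_mx mu delta eta (sd_sigma d)))
          (castmx (erefl n, en) (right_mx d ek))].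
Proof.
(* [eta] is forced: [2 eta] or [2 eta + 1] equals [k]. *)
move=> ad kn; pose delta := (k - k./2)%N; pose eta := k./2.
have ek : k = (delta + eta)%N by rewrite /delta /eta; lia.
have en : (nu + (mu + (delta + (nu + (mu + eta)))))%N = n by lia.
exists (nu + mu + eta)%N, delta, eta, ek, en; split=> //.
  have de : delta = eta \/ delta = eta.+1 by rewrite /delta /eta; lia.
  by case: de => de; [left | right]; split; lia.
(* Once [k] and [n] are replaced by the sums, all the casts are trivial. *)
move: delta eta ek en => delta eta ek en.
clear kn; subst k; subst n; rewrite !castmx_id; exact: svd_blocks.
Qed.

Theorem theorem3 (R : realType) :
  (forall (n : nat) (A : 'M[R[i]%C]_n), involutory A ->
     (exists (nu mu k : nat) (d : singular_data R n nu mu k),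
        has_singular_data A d) /\
     (forall (nu mu k : nat) (d : singular_data R n nu mu k),
        has_singular_data A d ->
        (forall j : 'I_nu,
           singular_triplet A (col j (sd_U d)) (col j (sd_V d))
             (sd_sigma d 0 j) /\
           singular_triplet A (col j (sd_V d)) (col j (sd_U d))
             (1 / sd_sigma d 0 j)) /\
        exists (m delta eta : nat) (ek : k = (delta + eta)%N)
          (en : (nu + (mu + (delta + (nu + (mu + eta)))))%N = n),
          [/\ (nu + mu + eta)%N = m,
              (n = (2 * m)%N /\ delta = eta) \/
              (n = (2 * m + 1)%N /\ delta = (eta + 1)%N)
            & is_svd A
                (castmx (erefl n, en) (left_mx d ek))
                (castmx (en, en) (sigma_mx mu delta eta (sd_sigma d)))
                (castmx (erefl n, en) (right_mx d ek))])) /\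
  (exists (n : nat) (A : 'M[R[i]%C]_n) (nu mu k : nat)
     (d : singular_data R n nu mu k) (j j' : 'I_k),
     [/\ involutory A, has_singular_data A d & sd_neg d j <> sd_neg d j']).
Proof.
split; last exact: mixed_signs.
move=> n A AA; split; first exact: exists_singular_data.
move=> nu mu k d hd; have ad := adapted_of_singular_data AA hd.
have [_ _ At] := ad; have [kn _ _ _ _] := hd; split; last exact: displayed_svd.
move=> j; rewrite div1r.
by split; [exact: (At (inl (inl j))) | exact: (At (inr j))].
Qed.
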